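(* Let $F$ be an algebraically closed field of characteristic $0$ and let $n\ge2$. The universal associative envelope $\mathfrak{A}$ of the simple anti-Jordan triple system $\mathfrak{J}$ of all $n\times n$ matrices over $F$ is semisimple.
   Context: $\mathfrak{J}$ is the space of $n\times n$ matrices over $F$ with trilinear product $\langle a,b,c\rangle=abc-cba$. With $\Omega=\{1,\dots,n\}$, its (unital) universal associative envelope is $\mathfrak{A}=F\langle X\rangle/I$, where $F\langle X\rangle$ is the free unital associative algebra on symbols $X=\{e_{i,j}\}_{i,j\in\Omega}$ (with $e_{i,j}$ corresponding to the matrix unit $E_{i,j}$), and $I$ is the two-sided ideal generated by all elements $e_{i,j}e_{k,\ell}e_{m,t}-e_{m,t}e_{k,\ell}e_{i,j}-\delta_{j,k}\delta_{\ell,m}e_{i,t}+\delta_{t,k}\delta_{\ell,i}e_{m,j}$ for $i,j,k,\ell,m,t\in\Omega$. *)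

(* Defs.v *)
From HB Require Import structures.
From mathcomp Require Import all_boot all_order all_algebra.
From mathcomp Require Import boolp classical_sets.
From mathcomp Require Import monalg.

Set Implicit Arguments.
Unset Strict Implicit.
Unset Printing Implicit Defensive.

Import GRing.Theory.
Local Open Scope ring_scope.
Local Open Scope quotient_scope.

Section TwoSidedIdeal.
Context (A : pzRingType).

Definition two_sided_ideal (I : set A) : Prop :=
  [/\ I 0,
      forall x y, I x -> I y -> I (x + y),
      forall a x, I x -> I (a * x) &
      forall a x, I x -> I (x * a)].

Definition ideal_generated (G : set A) : set A := smallest two_sided_ideal G.

Lemma ideal_generatedP (G : set A) : two_sided_ideal (ideal_generated G).
Proof.
split.
- by move=> J [[]].
- move=> x y Ix Iy J JG; have [[_ JD _ _] _] := JG.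
  by apply: JD; [apply: Ix|apply: Iy].
- by move=> a x Ix J JG; have [[_ _ Jl _] _] := JG; apply: Jl; exact: Ix.
- by move=> a x Ix J JG; have [[_ _ _ Jr] _] := JG; apply: Jr; exact: Ix.
Qed.

Context (I : set A) (I_ideal : two_sided_ideal I).

Lemma two_sided_ideal0 : I 0. Proof. by case: I_ideal. Qed.
Lemma two_sided_idealD x y : I x -> I y -> I (x + y).
Proof. by case: I_ideal => _ + _ _; apply. Qed.
Lemma two_sided_idealMl a x : I x -> I (a * x).
Proof. by case: I_ideal => _ _ + _; apply. Qed.
Lemma two_sided_idealMr a x : I x -> I (x * a).
Proof. by case: I_ideal => _ _ _; apply. Qed.
Lemma two_sided_idealN x : I x -> I (- x).
Proof. by rewrite -mulN1r; apply: two_sided_idealMl. Qed.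

End TwoSidedIdeal.

(* [A / (G)], for a ring [A] that need not be commutative: [ring_quotient]
   only provides the quotient ring in the commutative case. *)
Section QuotientRing.
Context (F : comNzRingType) (A : lalgType F) (G : set A).
Local Notation I := (ideal_generated G).

Definition ideal_equiv (x y : A) : bool := `[< I (x - y) >].

Lemma ideal_equiv_class : equiv_class_of ideal_equiv.
Proof.
have II := ideal_generatedP G.
split=> [x|x y|y x z].
- by apply/asboolP; rewrite subrr; apply: (two_sided_ideal0 II).
- by apply/asboolP/asboolP => /(two_sided_idealN II); rewrite opprB.
- move=> /asboolP xy /asboolP yz; apply/asboolP.
  by rewrite -[x](addrNK y) -addrA; apply: (two_sided_idealD II).
Qed.

Canonical ideal_equiv_equiv := EquivRelPack ideal_equiv_class.
Canonical ideal_equiv_encModRel := defaultEncModRel ideal_equiv.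

Definition quotient_ring := {eq_quot ideal_equiv}.
HB.instance Definition _ : EqQuotient A ideal_equiv quotient_ring :=
  EqQuotient.on quotient_ring.
HB.instance Definition _ := Choice.on quotient_ring.

Local Notation Q := quotient_ring.
Local Notation q := (\pi_Q).

Lemma quotient_ring_eq (x y : A) : I (x - y) <-> q x = q y.
Proof.
split=> [H|/eqP]; first by apply/eqP; rewrite piE; apply/asboolP.
by rewrite piE => /asboolP.
Qed.

Definition quot_zero : Q := q 0.
Definition quot_one : Q := q 1.
Definition quot_opp : Q -> Q := lift_op1 Q -%R.
Definition quot_add : Q -> Q -> Q := lift_op2 Q +%R.
Definition quot_mul : Q -> Q -> Q := lift_op2 Q *%R.
Definition quot_scale (c : F) : Q -> Q := lift_op1 Q ( *:%R c).

Let II := ideal_generatedP G.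
Let reprI (x : A) : I (repr (q x) - x).
Proof. by apply/quotient_ring_eq; rewrite reprK. Qed.

Lemma quot_oppE x : quot_opp (q x) = q (- x).
Proof.
unlock quot_opp; apply/quotient_ring_eq; rewrite -opprD.
apply: (two_sided_idealN II); exact: reprI.
Qed.

Lemma quot_addE x y : quot_add (q x) (q y) = q (x + y).
Proof.
unlock quot_add; apply/quotient_ring_eq; rewrite opprD addrACA.
by apply: (two_sided_idealD II); apply: reprI.
Qed.

Lemma quot_mulE x y : quot_mul (q x) (q y) = q (x * y).
Proof.
unlock quot_mul; apply/quotient_ring_eq.
rewrite -[_ * _](addrNK (x * repr (q y))) -mulrBl.
rewrite -addrA -mulrBr; apply: (two_sided_idealD II).
  by apply: (two_sided_idealMr II); apply: reprI.
by apply: (two_sided_idealMl II); apply: reprI.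
Qed.

Lemma quot_scaleE c x : quot_scale c (q x) = q (c *: x).
Proof.
unlock quot_scale; apply/quotient_ring_eq; rewrite -scalerBr -mulr_algl.
by apply: (two_sided_idealMl II); apply: reprI.
Qed.

Lemma quot_addA : associative quot_add.
Proof.
by move=> x y z; rewrite -[x]reprK -[y]reprK -[z]reprK !quot_addE addrA.
Qed.
Lemma quot_addC : commutative quot_add.
Proof. by move=> x y; rewrite -[x]reprK -[y]reprK !quot_addE addrC. Qed.
Lemma quot_add0 : left_id quot_zero quot_add.
Proof. by move=> x; rewrite -[x]reprK quot_addE add0r. Qed.
Lemma quot_addN : left_inverse quot_zero quot_opp quot_add.
Proof. by move=> x; rewrite -[x]reprK quot_oppE quot_addE addNr. Qed.

HB.instance Definition _ :=
  GRing.isZmodule.Build Q quot_addA quot_addC quot_add0 quot_addN.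

Lemma quot_mulA : associative quot_mul.
Proof.
by move=> x y z; rewrite -[x]reprK -[y]reprK -[z]reprK !quot_mulE mulrA.
Qed.
Lemma quot_mul1 : left_id quot_one quot_mul.
Proof. by move=> x; rewrite -[x]reprK quot_mulE mul1r. Qed.
Lemma quot_mulr1 : right_id quot_one quot_mul.
Proof. by move=> x; rewrite -[x]reprK quot_mulE mulr1. Qed.
Lemma quot_mulDl : left_distributive quot_mul +%R.
Proof.
move=> x y z; rewrite -[x]reprK -[y]reprK -[z]reprK.
by rewrite /+%R /= !(quot_addE, quot_mulE) mulrDl.
Qed.
Lemma quot_mulDr : right_distributive quot_mul +%R.
Proof.
move=> x y z; rewrite -[x]reprK -[y]reprK -[z]reprK.
by rewrite /+%R /= !(quot_addE, quot_mulE) mulrDr.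
Qed.

HB.instance Definition _ := GRing.Zmodule_isPzRing.Build Q
  quot_mulA quot_mul1 quot_mulr1 quot_mulDl quot_mulDr.

Lemma quot_scaleA a b v : quot_scale a (quot_scale b v) = quot_scale (a * b) v.
Proof. by rewrite -[v]reprK !quot_scaleE scalerA. Qed.
Lemma quot_scale1 : left_id 1 quot_scale.
Proof. by move=> x; rewrite -[x]reprK quot_scaleE scale1r. Qed.
Lemma quot_scaleDr : right_distributive quot_scale +%R.
Proof.
move=> c x y; rewrite -[x]reprK -[y]reprK.
by rewrite /+%R /= !(quot_addE, quot_scaleE) scalerDr.
Qed.
Lemma quot_scaleDl v : {morph quot_scale^~ v : a b / a + b}.
Proof.
move=> a b; rewrite /= -[v]reprK !quot_scaleE scalerDl.
by rewrite [RHS]quot_addE.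
Qed.

HB.instance Definition _ := GRing.Zmodule_isLmodule.Build F Q
  quot_scaleA quot_scale1 quot_scaleDr quot_scaleDl.

Definition quot_map (x : A) : Q := q x.

Lemma quot_map_is_zmod_morphism : zmod_morphism quot_map.
Proof.
by move=> x y; rewrite /quot_map /+%R /-%R /= quot_oppE quot_addE.
Qed.
HB.instance Definition _ :=
  GRing.isZmodMorphism.Build A Q quot_map quot_map_is_zmod_morphism.
Lemma quot_map_is_monoid_morphism : monoid_morphism quot_map.
Proof. by split=> // x y; rewrite /quot_map /*%R /= quot_mulE. Qed.
HB.instance Definition _ :=
  GRing.isMonoidMorphism.Build A Q quot_map quot_map_is_monoid_morphism.
Lemma quot_map_is_scalable : scalable quot_map.
Proof. by move=> c x; rewrite /quot_map [RHS]quot_scaleE. Qed.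
HB.instance Definition _ :=
  GRing.isScalable.Build F A Q *:%R quot_map quot_map_is_scalable.

Lemma quot_map_surj (u : Q) : exists x, u = quot_map x.
Proof. by exists (repr u); rewrite /quot_map reprK. Qed.

Lemma quot_map_eq0 x : quot_map x = 0 <-> I x.
Proof. by rewrite -[x in I x]subr0; symmetry; apply: quotient_ring_eq. Qed.

End QuotientRing.

Lemma fmonom_malg_scalerAr (F : comNzRingType) (X : choiceType) (c : F)
    (x y : {malg F[{fmonom X}]}) :
  c *: (x * y) = x * (c *: y).
Proof.
apply/malgP => k.
rewrite mcoeffZ [in LHS](@mcoeffMlw _ _ (msupp x) (msupp y)) //.
rewrite [RHS](@mcoeffMlw _ _ (msupp x) (msupp y)) ?msuppZ_le //.
rewrite mulr_sumr; apply: eq_bigr => k1 _; rewrite mulr_sumr.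
by apply: eq_bigr => k2 _; rewrite mcoeffZ mulrnAr mulrCA.
Qed.

(* F<X> on the symbols X = {e_ij}: the algebra of the free monoid on X. *)
Notation free_algebra F n := {malg F[{fmonom ('I_n * 'I_n)%type}]}.

Section Envelope.
Context (F : fieldType) (n : nat).
Local Notation free_algebra := (free_algebra F n).

Definition e (i j : 'I_n) : free_algebra := << fmu (i, j) >>.

Definition relator (i j k l m t : 'I_n) : free_algebra :=
  e i j * e k l * e m t - e m t * e k l * e i j
  - ((j == k)%:R * (l == m)%:R) *: e i t
  + ((t == k)%:R * (l == i)%:R) *: e m j.

Definition relators : set free_algebra :=
  fun r => exists i j k l m t, r = relator i j k l m t.

Definition envelope := quotient_ring relators.
HB.instance Definition _ := GRing.PzRing.on envelope.
HB.instance Definition _ := GRing.Lmodule.on envelope.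

(* The relators do say that [e] respects the triple product of matrices. *)
Definition triple_product (a b c : 'M[F]_n) : 'M[F]_n :=
  a *m b *m c - c *m b *m a.

Definition matrix_lift (a : 'M[F]_n) : free_algebra :=
  \sum_i \sum_j a i j *: e i j.

Lemma matrix_liftB a b : matrix_lift (a - b) = matrix_lift a - matrix_lift b.
Proof.
rewrite /matrix_lift -sumrB; apply: eq_bigr => i _.
by rewrite -sumrB; apply: eq_bigr => j _; rewrite !mxE scalerBl.
Qed.

Lemma matrix_liftZ c a : matrix_lift (c *: a) = c *: matrix_lift a.
Proof.
rewrite /matrix_lift scaler_sumr; apply: eq_bigr => i _.
by rewrite scaler_sumr; apply: eq_bigr => j _; rewrite !mxE scalerA.
Qed.

Lemma sum_delta_mx (V : lmodType F) (f : 'I_n -> 'I_n -> V) i j :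
  \sum_k \sum_l (delta_mx i j : 'M[F]_n) k l *: f k l = f i j.
Proof.
rewrite (bigD1 i) //= (bigD1 j) //= !mxE !eqxx scale1r.
rewrite big1 ?addr0 => [|k /negPf kj]; last by rewrite mxE kj andbF scale0r.
rewrite big1 ?addr0 // => k /negPf ki; rewrite big1 // => l _.
by rewrite mxE ki scale0r.
Qed.

Lemma matrix_lift_delta i j : matrix_lift (delta_mx i j) = e i j.
Proof. exact: sum_delta_mx. Qed.

Lemma relatorE i j k l m t :
  relator i j k l m t =
  e i j * e k l * e m t - e m t * e k l * e i j
  - matrix_lift
      (triple_product (delta_mx i j) (delta_mx k l) (delta_mx m t)).
Proof.
have dE (a b c d g h : 'I_n) :
    delta_mx a b *m delta_mx c d *m delta_mx g h
    = ((b == c)%:R * (d == g)%:R) *: delta_mx a h :> 'M[F]_n.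
  rewrite mul_delta_mx_cond -scaler_nat -scalemxAl mul_delta_mx_cond.
  by rewrite -scaler_nat scalerA.
rewrite /triple_product !dE matrix_liftB !matrix_liftZ !matrix_lift_delta.
by rewrite opprB /relator [LHS]addrAC -!addrA.
Qed.

(* [envelope] is nonzero, as the relators have no constant term. *)
Lemma envelope_oner_neq0 : (1 : envelope) != 0.
Proof.
apply/eqP => /(@quot_map_eq0 F free_algebra relators 1) I1.
pose c0 : free_algebra -> F := @mcoeff {fmonom ('I_n * 'I_n)%type} F mone.
have c0e i j : c0 (e i j) = 0 by rewrite /c0 mcoeffU1 -val_eqE /= fmuE fm1.
have c01 : c0 1 = 1 by rewrite /c0 mcoeff1 eqxx.
suff c010 : c0 1 = 0 by move/eqP: c010; rewrite c01 oner_eq0.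
have c0M x y : c0 (x * y) = c0 x * c0 y by rewrite /c0 rmorphM.
have c0D x y : c0 (x + y) = c0 x + c0 y by rewrite /c0 mcoeffD.
have c0N x : c0 (- x) = - c0 x by rewrite /c0 mcoeffN.
have c0Z a x : c0 (a *: x) = a * c0 x by rewrite /c0 mcoeffZ.
clearbody c0.
have c0L x y z t : c0 x = 0 -> c0 y = 0 -> c0 z = 0 -> c0 t = 0 ->
    c0 (x - y - z + t) = 0.
  by move=> x0 y0 z0 t0; rewrite !(c0D, c0N) x0 y0 z0 t0 !subr0 addr0.
have c0M3 x y z : c0 z = 0 -> c0 (x * y * z) = 0.
  by move=> z0; rewrite c0M z0 mulr0.
have := I1 (fun x => c0 x = 0); apply; split=> [|r /=].
  split=> /= [|x y x0 y0|a x x0|a x x0].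
  - by rewrite -[0 in LHS](subrr 1) c0D c0N subrr.
  - by rewrite c0D x0 y0 addr0.
  - by rewrite c0M x0 mulr0.
  - by rewrite c0M x0 mul0r.
move=> [i [j [k [l [m [t ->]]]]]].
rewrite /relator; apply: c0L.
- by apply: c0M3; apply: c0e.
- by apply: c0M3; apply: c0e.
- by rewrite c0Z c0e mulr0.
- by rewrite c0Z c0e mulr0.
Qed.

HB.instance Definition _ :=
  GRing.PzSemiRing_isNonZero.Build envelope envelope_oner_neq0.

Lemma envelope_scalerAl (c : F) (u v : envelope) : c *: (u * v) = c *: u * v.
Proof.
have [x ->] := quot_map_surj u; have [y ->] := quot_map_surj v.
by rewrite -rmorphM -!linearZ -rmorphM -scalerAl.
Qed.

HB.instance Definition _ :=
  GRing.Lmodule_isLalgebra.Build F envelope envelope_scalerAl.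

Lemma envelope_scalerAr (c : F) (u v : envelope) : c *: (u * v) = u * (c *: v).
Proof.
have [x ->] := quot_map_surj u; have [y ->] := quot_map_surj v.
rewrite -rmorphM -!linearZ -[RHS]rmorphM; congr quot_map.
exact: fmonom_malg_scalerAr.
Qed.

HB.instance Definition _ :=
  GRing.Lalgebra_isAlgebra.Build F envelope envelope_scalerAr.

End Envelope.

Arguments e {F n} i j.
Arguments relator {F n} i j k l m t.

Section Semisimple.

Definition simple_submodule (R : pzRingType) (M : lmodType R) (N : {pred M}) :
    Prop :=
  [/\ submod_closed N,
      exists2 x, x \in N & x != 0 &
      forall N' : {pred M}, submod_closed N' -> {subset N' <= N} ->
        N' =i pred1 0 \/ N' =i N].

(* The left regular module, written [R^o], is an internal direct sum of simple
   submodules; finitely many are enough because 1 generates it. *)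
Definition semisimple (R : pzRingType) : Prop :=
  exists (k : nat) (L : 'I_k -> {pred R^o}),
    (forall i, simple_submodule (L i)) /\
    (forall x : R^o, exists! u : {ffun 'I_k -> R^o},
       (forall i, u i \in L i) /\ x = \sum_i u i).

End Semisimple.

(* Main.v *)
Require Import Defs.
From mathcomp Require Import all_boot all_order all_algebra.
From mathcomp Require Import boolp monalg.
Import GRing.Theory.
Local Open Scope ring_scope.

(** Let [A] be the envelope, generated by the classes of the [e i j].  It has
    five evident irreducible modules: the trivial one, and [F^n] with [e i j]
    acting as [s E_ij] where [s^2 = 1], or as [s E_ji] where [s^2 = -1].  Behind
    the second pair is a symmetry of the relations, the twist
    [e i j |-> iota e j i] with [iota^2 = -1].  The proof exhibits, inside [A],
    matrix units for these blocks.

    Where [e i j] acts as [s E_ij], the word [e i j * e j l * e l t] acts as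
    [s E_it]; in the transposed blocks it vanishes unless [l = i] and [j = t].
    So for [l <> i] or [j <> t] this word is a candidate for [s E_it], supported
    by the two blocks [s = 1] and [s = -1]; it is called [odd_unit i t].  The
    first task is to prove that it depends only on [i] and [t] ([odd_unitE]).
    Rearranging a product of four generators in two ways with the cubic
    relations yields quadratic relations ([bracket_exchange]), of which two
    suffice: [e i j * e k l = 0] when [j <> k] and [i <> l], and
    [e i j * e j l] does not depend on [j] when [i <> l].  Next, [e i j] is the
    sum of [odd_unit i j] and of a multiple of the [odd_unit j i] of the twist
    ([triple_decomp]).  It follows that [e i j * odd_unit j l] does not depend
    on [j] ([odd_exchange]); this is [even_unit i l], which stands for [E_il] in
    both blocks.  Left multiplication by [e i j] then exchanges odd and even
    units the way [s E_ij] should ([mul_odd], [mul_even]).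

    Hence the halves of [even_unit + odd_unit] and [even_unit - odd_unit] are
    matrix units, and doing the same for the twist gives four pairwise
    orthogonal blocks ([block_unit_mul]).  What their diagonal units leave out
    of [1] is an idempotent [null_unit] killed by every generator.  Thus [1] is
    a sum of orthogonal idempotents, and each nonzero one generates a simple
    left ideal, since a column of matrix units spans a left ideal on which the
    generators act transitively.  These ideals decompose [A]. *)

Set Implicit Arguments.
Unset Strict Implicit.
Unset Printing Implicit Defensive.

(** * Semisimplicity from orthogonal idempotents *)

Section Idempotents.
Context (R : pzRingType).

Definition minimal_idempotent (f : R) : Prop :=
  [/\ f * f = f, f != 0 & forall x, x * f != 0 -> exists y, y * (x * f) = f].

(** This is [R f] when [f] is idempotent. *)
Definition left_ideal (f : R) : {pred R^o} := [pred x : R^o | x * f == x].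

Lemma left_idealE f x : (x \in left_ideal f) = (x * f == x).
Proof. by rewrite inE. Qed.

Lemma minimal_idempotent_simple f :
  minimal_idempotent f -> simple_submodule (left_ideal f).
Proof.
case=> ff f_neq0 f_min; split.
- split=> [|a x y] /=; rewrite !left_idealE ?mul0r // => /eqP xf /eqP yf.
  by rewrite mulrDl -mulrA xf yf.
- by exists f => //; rewrite left_idealE ff.
move=> N [N0 NZD] sNf; have [N_eq0|] := EM (forall x, x \in N -> x = 0).
  left=> x; apply/idP/eqP => [/N_eq0 //|->]; exact: N0.
case/existsNP=> x /not_implyP [Nx /eqP x_neq0]; right=> y.
have NM a u : u \in N -> a * u \in N
  by move=> Nu; have := NZD a u 0 Nu N0; rewrite addr0.
apply/idP/idP => [/sNf//|]; rewrite left_idealE => /eqP <-.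
have /eqP xf : x * f == x by have := sNf x Nx; rewrite left_idealE.
by have [|a <-] := f_min x; [rewrite xf | rewrite xf mulrA; apply: NM].
Qed.

(** Some [f t] may vanish: only the nonzero ones index the decomposition. *)
Lemma semisimple_of_idempotents (T : finType) (f : T -> R) :
    (forall s t, f s * f t = f t *+ (s == t)) -> \sum_t f t = 1 ->
    (forall t, f t != 0 -> minimal_idempotent (f t)) ->
  semisimple R.
Proof.
move=> f_orth f_sum f_min; pose A := [pred t | f t != 0].
pose g (i : 'I_#|A|) := f (enum_val i).
have g_orth i j : g i * g j = g j *+ (i == j).
  by rewrite /g f_orth (inj_eq enum_val_inj).
have g_sum : \sum_i g i = 1.
  rewrite /g -(big_enum_val f) big_mkcond -f_sum.
  by apply: eq_bigr => t _; rewrite inE; case: eqP.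
exists #|A|, (fun i => left_ideal (g i)); split=> [i|x].
  by apply: minimal_idempotent_simple; apply: f_min; have := enum_valP i.
exists [ffun i => x * g i]; split.
  split=> [i|]; first by rewrite ffunE left_idealE -mulrA g_orth eqxx.
  rewrite -[LHS](mulr1 (x : R)) -g_sum mulr_sumr.
  by apply: eq_bigr => i _; rewrite ffunE.
move=> u [ug ->]; apply/ffunP => j; rewrite ffunE mulr_suml (bigD1 j) //=.
have := ug j; rewrite left_idealE => /eqP->.
rewrite big1 ?addr0 // => i /negPf i_neq_j.
have := ug i; rewrite left_idealE => /eqP<-.
by rewrite -mulrA g_orth i_neq_j mulr0.
Qed.

End Idempotents.

(** * Consequences of the cubic relations *)

Section TripleFamilies.
Context (F : fieldType) (R : algType F) (n : nat).
Implicit Types e : 'I_n -> 'I_n -> R.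

Variables (o : 'I_n -> 'I_n) (oP : forall i, o i != i).
Hypothesis two_neq0 : (2%:R : F) != 0.

(** The image of the triple product of [E_ij], [E_kl], [E_mt] under the linear
    map that sends [E_ij] to [e i j]. *)
Definition bracket e i j k l m t : R :=
  e i t *+ ((j == k) && (l == m)) - e m j *+ ((t == k) && (l == i)).

Definition triple_family e := forall i j k l m t,
  e i j * e k l * e m t - e m t * e k l * e i j = bracket e i j k l m t.

(** That [e] generates [R] as a unital algebra, in the form of an induction
    principle: a subspace stable under the generators is a left ideal. *)
Definition generating e := forall V : R -> Prop,
    V 0 -> (forall x y, V x -> V y -> V (x + y)) ->
    (forall c x, V x -> V (c *: x)) ->
    (forall i j x, V x -> V (e i j * x)) ->
  forall x y, V y -> V (x * y).

Section OneFamily.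
Variables (e : 'I_n -> 'I_n -> R) (e_triple : triple_family e).

(** Reversing the outer factors of the left or the right three letters of
    [a b c d], in either order, leads to [c d a b]; the two ways of accumulating
    the brackets must agree. *)
Lemma bracket_exchange a1 a2 b1 b2 c1 c2 d1 d2 :
  e c1 c2 * bracket e b1 b2 a1 a2 d1 d2 + bracket e a1 a2 b1 b2 c1 c2 * e d1 d2
  = bracket e a1 a2 d1 d2 c1 c2 * e b1 b2
    + e a1 a2 * bracket e b1 b2 c1 c2 d1 d2.
Proof.
rewrite -!e_triple !mulrBr !mulrBl !mulrA.
by rewrite addrC subrKA [RHS]addrC subrKA.
Qed.

Lemma triple_mul0 i j k l : j != k -> i != l -> e i j * e k l = 0.
Proof.
move=> /negPf jk /negPf il; have li : (l == i) = false by rewrite eq_sym.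
(* a = E_ik, b = E_ki, c = E_ij, d = E_kl: the brackets (b a d) and (a b c)
   both contribute e_ij e_kl, hence a factor 2, and the other two vanish. *)
have := bracket_exchange i k k i i j k l.
rewrite /bracket !eqxx ?jk ?il ?li ?andbF /= ?mulr0n ?mulr1n.
rewrite !subr0 mul0r mulr0 addr0 => double; apply: (scalerI two_neq0).
by rewrite scaler0 scaler_nat mulr2n.
Qed.

Lemma triple_mul_mid i j u l : i != l -> e i j * e j l = e i u * e u l.
Proof.
move=> /negPf il; have li : (l == i) = false by rewrite eq_sym.
have [-> //|/negPf ju] := eqVneq j u.
have uj : (u == j) = false by rewrite eq_sym.
(* a = E_iu, b = E_ji, c = E_ij, d = E_ul. *)
have := bracket_exchange i u j i i j u l.
rewrite /bracket !eqxx ?ju ?uj ?il ?li ?andbF /= ?mulr0n ?mulr1n.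
rewrite !subr0 sub0r mul0r mulr0 addr0 mulNr => /eqP.
by rewrite subr_eq0 => /eqP.
Qed.

Definition odd_unit i t := e i i * e i (o i) * e (o i) t.

(** The admissible middle pairs [(j, l)] are all but [(t, i)]: moving [l] is
    allowed when [j != t] and moving [j] when [l != i], and these moves connect
    them all. *)
Lemma odd_unitE j l i t : (l != i) || (j != t) ->
  odd_unit i t = e i j * e j l * e l t.
Proof.
have oj j' : j' != t -> odd_unit i t = e i j' * e j' l * e l t.
  move=> jt; rewrite -mulrA (triple_mul_mid l (o i)) // mulrA.
  by rewrite (triple_mul_mid j' i) // eq_sym oP.
case/orP=> [li|/oj//]; rewrite (triple_mul_mid j (o t)) ?[i == _]eq_sym //.
by apply: oj; rewrite oP.
Qed.

Definition even_unit i l := e i i * odd_unit i l.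

Lemma mul_odd0 i j k l : j != k -> e i j * odd_unit k l = 0.
Proof.
move=> jk; rewrite (@odd_unitE (o i) (o k)) ?oP // !mulrA.
by rewrite triple_mul0 ?mul0r // eq_sym oP.
Qed.

Lemma odd_mul0 i j k l : j != k -> odd_unit i j * e k l = 0.
Proof.
move=> jk; rewrite (@odd_unitE (o j) (o l)) ?oP ?orbT // -!mulrA.
by rewrite triple_mul0 ?mulr0 // oP.
Qed.

End OneFamily.

(** * The twist and the matrix units *)

Section Twist.
Variables (iota : F) (iota2 : iota * iota = -1).

(** Transposition reverses products, hence negates the triple product; the
    factor [iota] restores the sign, as [iota ^+ 3 = - iota]. *)
Definition twist e i j : R := iota *: e j i.

Lemma twistK e i j : e i j = - iota *: twist e j i.
Proof. by rewrite /twist scalerA mulNr iota2 opprK scale1r. Qed.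

Lemma twist_triple e : triple_family e -> triple_family (twist e).
Proof.
move=> e_triple i j k l m t.
rewrite /bracket /twist -!(scalerAl, scalerAr) !scalerA iota2 mulrN1 -scalerBr.
rewrite e_triple /bracket !scalerMnr -scalerBr scaleNr -scalerN opprB.
by rewrite ![l == _]eq_sym [k == j]eq_sym [k == t]eq_sym
  [(m == l) && _]andbC [(i == l) && _]andbC.
Qed.

Lemma twist_generating e : generating e -> generating (twist e).
Proof.
move=> e_gen V V0 VD VZ Ve; apply: e_gen => // i j x Vx.
by rewrite (twistK e) -scalerAl; apply/VZ/Ve.
Qed.

Section Multiplication.
Variables (e : 'I_n -> 'I_n -> R) (e_triple : triple_family e).
Let te_triple := twist_triple e_triple.
Local Notation p := (odd_unit e).
Local Notation P := (even_unit e).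
Local Notation p' := (odd_unit (twist e)).

(** The cubic relation with bracket [e i t]: one of its two words is an odd
    unit of [e], the other is one of the twist, up to a scalar. *)
Lemma triple_decomp i t : e i t = p i t - iota *: p' t i.
Proof.
have := e_triple i (o t) (o t) (o t) (o t) t.
rewrite /bracket !eqxx [t == o t]eq_sym (negPf (oP t)) mulr1n subr0 => <-.
rewrite -(odd_unitE e_triple) ?oP ?orbT //; congr (_ - _).
rewrite (odd_unitE te_triple (j := o t) (l := o t)) ?oP //.
rewrite /twist -!(scalerAl, scalerAr) !scalerA iota2 mulrN1 opprK.
by rewrite scale1r.
Qed.

Lemma mul_twist_odd0 i j k l : i != k -> e i j * p' k l = 0.
Proof.
by move=> ik; rewrite (twistK e) -scalerAl (mul_odd0 te_triple) ?scaler0.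
Qed.

Lemma twist_odd_mul0 i j k l : j != l -> p' i j * e k l = 0.
Proof.
by move=> jl; rewrite (twistK e) -scalerAr (odd_mul0 te_triple) ?scaler0.
Qed.

Lemma mul_odd_neq i j l : i != l -> e i j * p j l = e i j * e j l.
Proof.
move=> il; rewrite (triple_decomp j l) mulrBr -scalerAr.
by rewrite mul_twist_odd0 // scaler0 subr0.
Qed.

Lemma odd_mul_neq i j l : i != l -> p i j * e j l = e i j * e j l.
Proof.
move=> il; rewrite (triple_decomp i j) mulrBl -scalerAl.
by rewrite twist_odd_mul0 // scaler0 subr0.
Qed.

(** Both sides are the word [e i j * e j a * e a b * e b l], provided that
    [(a, b)] is an admissible middle pair for [p j l] and [(j, a)] one for
    [p i b].  When [j = b] and [i != l] this asks for an index [a] other than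
    [i] and [l], which does not exist if [n = 2]; in that case both sides reduce
    to [e i j * e j l], because the twisted part of [e] contributes nothing. *)
Lemma odd_exchange i j b l : e i j * p j l = p i b * e b l.
Proof.
have pE := odd_unitE e_triple.
have [<-{b}|jb] := eqVneq j b; last first.
  rewrite (pE l b j l) ?[b == j]eq_sym ?jb // (pE j l i b) ?jb ?orbT //.
  by rewrite !mulrA.
have [<-|il] := eqVneq i l; last by rewrite mul_odd_neq // odd_mul_neq.
by rewrite (pE (o i) j j i) ?oP ?orbT // (pE j (o i) i j) ?oP // !mulrA.
Qed.

Lemma mul_odd i j k l : e i j * p k l = P i l *+ (j == k).
Proof.
have [<-|jk] := eqVneq j k; last by rewrite (mul_odd0 e_triple).
by rewrite (odd_exchange i j i l) -(odd_exchange i i i l).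
Qed.

Lemma mul_even i j k l : e i j * P k l = p i l *+ (j == k).
Proof.
have PE b : P k l = p k b * e b l.
  by rewrite -(odd_exchange k k b l).
have [jk|jk] := eqVneq j k; last first.
  by rewrite (PE k) mulrA (mul_odd0 e_triple) ?mul0r.
(* o i as inner index makes e_ij e_j(o i) e_(o i)l an odd unit. *)
rewrite (PE (o i)) jk mulrA mul_odd_neq; last by rewrite eq_sym oP.
by rewrite mulr1n -(odd_unitE e_triple) ?oP.
Qed.

End Multiplication.

(** The [v k] transform like the standard basis of [F^n], with [e i j] acting
    as [c E_ij]. *)
Definition equivariant e (c : F) (v : 'I_n -> R) :=
  forall i j k, e i j * v k = (c *: v i) *+ (j == k).

(** The part of [E_kl] in the block where [e i j] acts as [(-1) ^+ s E_ij]. *)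
Definition matrix_unit e (s : bool) k l : R :=
  2%:R^-1 *: (even_unit e k l + ((-1) ^+ s : F) *: odd_unit e k l).

Lemma matrix_unit_equivariant e (s : bool) l : triple_family e ->
  equivariant e ((-1) ^+ s) (fun k => matrix_unit e s k l).
Proof.
move=> e_triple i j k; rewrite /matrix_unit -scalerAr mulrDr -scalerAr.
rewrite (mul_even e_triple) (mul_odd e_triple).
rewrite [in RHS]scalerA [in RHS]mulrC -[in RHS]scalerA.
rewrite [(-1) ^+ s *: (_ + _)]scalerDr [(-1) ^+ s *: (_ *: _)]scalerA.
rewrite -signr_addb addbb scale1r -scalerMnr addrC -mulrnDl.
by rewrite -scalerMnr.
Qed.

Lemma matrix_unit_sum e k l :
  matrix_unit e false k l + matrix_unit e true k l = even_unit e k l.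
Proof.
rewrite /matrix_unit expr0 expr1 -scalerDr scaleN1r scale1r addrACA subrr addr0.
by rewrite -mulr2n -[X in _ *: X]scaler_nat scalerA mulVf ?scale1r.
Qed.

Lemma odd_mul_equivariant e c v i j k : equivariant e c v ->
  odd_unit e i j * v k = (c ^+ 3 *: v i) *+ (j == k).
Proof.
move=> ev; rewrite /odd_unit -!mulrA ev !mulrnAr -scalerAr ev eqxx mulr1n.
by rewrite -!scalerAr ev eqxx mulr1n !scalerA !exprS mulr1 !mulrA.
Qed.

Lemma matrix_unit_mul_equivariant e r (s : bool) v i j k :
  equivariant e ((-1) ^+ s) v ->
  matrix_unit e r i j * v k = v i *+ ((r == s) && (j == k)).
Proof.
move=> ev; rewrite /matrix_unit /even_unit -scalerAl mulrDl -scalerAl -mulrA.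
rewrite (odd_mul_equivariant _ _ _ ev) mulrnAr -scalerAr ev eqxx mulr1n.
have [_|_] := eqVneq j k; last by rewrite andbF !mulr0n scaler0 addr0 scaler0.
rewrite andbT !mulr1n !scalerA -scalerDl scalerA.
rewrite -[v i *+ _]scaler_nat; congr (_ *: _).
rewrite exprS sqrr_sign mulr1 -!signr_addb addbb -negb_eqb.
by case: (r == s); rewrite ?subrr ?mulr0 // mulVf.
Qed.

Lemma matrix_unit_mul_null e r v i j :
  (forall k l, e k l * v = 0) -> matrix_unit e r i j * v = 0.
Proof.
move=> ev; rewrite /matrix_unit /even_unit /odd_unit -scalerAl mulrDl -scalerAl.
by rewrite -!mulrA ev !mulr0 scaler0 addr0 scaler0.
Qed.

(** A word for the odd unit may be chosen so that its last letter kills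
    [v k], as the twisted action tests the first index of that letter. *)
Lemma matrix_unit_mul_twisted e r c v i j k : triple_family e ->
  equivariant (twist e) c v -> matrix_unit e r i j * v k = 0.
Proof.
move=> e_triple ev.
have pv i' : odd_unit e i' j * v k = 0.
  rewrite (odd_unitE e_triple (l := o k) (j := o j)) ?oP ?orbT // -mulrA.
  by rewrite (twistK e (o k)) -scalerAl ev (negPf (oP k)) mulr0n scaler0 mulr0.
by rewrite /matrix_unit /even_unit -scalerAl mulrDl -scalerAl -mulrA !pv mulr0
  scaler0 addr0 scaler0.
Qed.

Lemma twist_twist_equivariant e c v :
  equivariant e c v -> equivariant (twist (twist e)) (- c) v.
Proof.
move=> ev i j k; rewrite /twist scalerA iota2 scaleN1r mulNr ev scaleNr.
by rewrite mulNrn.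
Qed.

(** The [v m] span a left ideal, so [x * v k] is a combination of them, and
    [e k m] carries any nonzero term of it to a multiple of [v k]. *)
Lemma equivariant_minimal e c v k : generating e -> equivariant e c v ->
  c != 0 -> v k * v k = v k -> v k != 0 -> minimal_idempotent (v k).
Proof.
move=> e_gen ev c_neq0 vv v_neq0; split=> // x.
have eM i j (a : 'I_n -> F) : e i j * (\sum_m a m *: v m) = (a j * c) *: v i.
  rewrite mulr_sumr (bigD1 j) //= -scalerAr ev eqxx mulr1n scalerA.
  rewrite big1 ?addr0 // => m mj.
  by rewrite -scalerAr ev eq_sym (negPf mj) scaler0.
pose V y := exists a : 'I_n -> F, y = \sum_m a m *: v m.
have Vv m : V (v m).
  exists (fun m' => (m' == m)%:R); rewrite (bigD1 m) //= eqxx scale1r.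
  by rewrite big1 ?addr0 // => m' /negPf->; rewrite scale0r.
have VD y z : V y -> V z -> V (y + z).
  move=> [a ->] [b ->]; exists (fun m => a m + b m); rewrite -big_split /=.
  by apply: eq_bigr => m _; rewrite scalerDl.
have VZ d y : V y -> V (d *: y).
  move=> [a ->]; exists (fun m => d * a m); rewrite scaler_sumr.
  by apply: eq_bigr => m _; rewrite scalerA.
have [||a ->] := e_gen V _ VD VZ _ x (v k) (Vv k).
- by exists (fun=> 0); rewrite big1 // => m _; rewrite scale0r.
- by move=> i j y [a ->]; rewrite eM; apply/VZ/Vv.
move=> sum_neq0; have [m am_neq0] : exists m, a m != 0.
  apply/existsP; apply: contraNT sum_neq0; rewrite negb_exists => /forallP a0.
  by rewrite big1 // => m _; have /negPn/eqP-> := a0 m; rewrite scale0r.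
exists ((a m * c)^-1 *: e k m); rewrite -scalerAl eM scalerA mulVf ?scale1r //.
by rewrite mulf_neq0.
Qed.

Lemma null_minimal e v : generating e -> (forall i j, e i j * v = 0) ->
  v * v = v -> v != 0 -> minimal_idempotent v.
Proof.
move=> e_gen ev vv v_neq0; split=> // x.
have [|||||a ->] := e_gen (fun y => exists a : F, y = a *: v) _ _ _ _ x v.
- by exists 0; rewrite scale0r.
- by move=> _ _ [a ->] [b ->]; exists (a + b); rewrite scalerDl.
- by move=> c _ [a ->]; exists (c * a); rewrite scalerA.
- by move=> i j _ [a ->]; exists 0; rewrite -scalerAr ev scaler0 scale0r.
- by exists 1; rewrite scale1r.
rewrite scaler_eq0 negb_or => /andP[a_neq0 _].
by exists a^-1%:A; rewrite -scalerAl mul1r scalerA mulVf ?scale1r.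
Qed.

(** * Decomposition of the algebra *)

Section Decomposition.
Variables (e : 'I_n -> 'I_n -> R) (e_triple : triple_family e).
Hypothesis e_gen : generating e.

Definition twist_if (b : bool) := if b then twist e else e.

Lemma twist_if_triple b : triple_family (twist_if b).
Proof. by case: b => //; apply: twist_triple. Qed.

Lemma twist_if_generating b : generating (twist_if b).
Proof. by case: b => //; apply: twist_generating. Qed.

Definition block_unit b s k l := matrix_unit (twist_if b) s k l.

Lemma block_unit_mul b r i j c s k l : block_unit b r i j * block_unit c s k l =
  block_unit b r i l *+ [&& b == c, r == s & j == k].
Proof.
have W_eq := matrix_unit_equivariant s l (twist_if_triple c).
have [bc|bc] /= := eqVneq b c.
  subst c; rewrite [LHS](matrix_unit_mul_equivariant _ _ _ _ W_eq).
  by have [->|_] := eqVneq r s.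
(* Twisting twice negates e, whence the sign when b is the twisted side. *)
pose d : F := (if c then 1 else -1) * (-1) ^+ s.
pose v m := block_unit c s m l.
apply: (@matrix_unit_mul_twisted _ _ d v _ _ _ (twist_if_triple b)).
rewrite {}/d {}/v; case: b c bc W_eq => [] [] //= _ W_eq.
  by rewrite mulN1r; apply: twist_twist_equivariant.
by rewrite mul1r; exact: W_eq.
Qed.

Definition null_unit : R :=
  1 - \sum_(bk : bool * 'I_n) even_unit (twist_if bk.1) bk.2 bk.2.

(** The even diagonal units of [e] and of its twist turn [e i j] into the two
    summands of [triple_decomp]. *)
Lemma mul_null_unit i j : e i j * null_unit = 0.
Proof.
have sum_even : \sum_k e i j * even_unit e k k = odd_unit e i j.
  rewrite (bigD1 j) //= (mul_even e_triple) eqxx big1 ?addr0 // => k kj.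
  by rewrite (mul_even e_triple) eq_sym (negPf kj).
have sum_twist : \sum_k e i j * even_unit (twist e) k k
    = - iota *: odd_unit (twist e) j i.
  have eP k : e i j * even_unit (twist e) k k
      = - iota *: (odd_unit (twist e) j k *+ (i == k)).
    by rewrite (twistK e i) -scalerAl (mul_even (twist_triple e_triple)).
  rewrite (bigD1 i) //= eP eqxx big1 ?addr0 // => k ki.
  by rewrite eP eq_sym (negPf ki) scaler0.
rewrite /null_unit -(pair_bigA _ (fun b k => even_unit (twist_if b) k k)) /=.
rewrite big_bool /= mulrBr mulr1 mulrDr !mulr_sumr sum_even sum_twist.
by rewrite (triple_decomp e_triple i j) scaleNr [- _ + odd_unit _ _ _]addrC
  subrr.
Qed.

Lemma twist_if_null_unit b i j : twist_if b i j * null_unit = 0.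
Proof. by case: b; rewrite /= ?/twist -?scalerAl mul_null_unit ?scaler0. Qed.

Lemma block_unit_mul_null b s k l : block_unit b s k l * null_unit = 0.
Proof. exact/matrix_unit_mul_null/twist_if_null_unit. Qed.

Lemma even_unit_sum b k l :
  even_unit (twist_if b) k l = \sum_s block_unit b s k l.
Proof. by rewrite big_bool /= addrC matrix_unit_sum. Qed.

Lemma null_unitE :
  null_unit = 1 - \sum_(u : bool * bool * 'I_n) block_unit u.1.1 u.1.2 u.2 u.2.
Proof.
rewrite /null_unit; congr (_ - _).
rewrite -(pair_bigA _ (fun b k => even_unit (twist_if b) k k)) /=.
rewrite -(pair_bigA _ (fun bs k => block_unit bs.1 bs.2 k k)) /=.
rewrite -(pair_bigA _ (fun b s => \sum_k block_unit b s k k)) /=.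
apply: eq_bigr => b _; rewrite exchange_big /=.
by apply: eq_bigr => k _; rewrite even_unit_sum.
Qed.

Lemma null_mul_block_unit b s k l : null_unit * block_unit b s k l = 0.
Proof.
rewrite null_unitE mulrBl mul1r mulr_suml (bigD1 (b, s, k)) //=.
rewrite block_unit_mul !eqxx big1 ?addr0 ?subrr // => -[[c r] i] /= /negPf neq.
by rewrite block_unit_mul andbA; move: neq; rewrite !xpair_eqE => ->.
Qed.

Lemma null_unit_idem : null_unit * null_unit = null_unit.
Proof.
rewrite {1}null_unitE mulrBl mul1r mulr_suml big1 ?subr0 // => u _.
exact: block_unit_mul_null.
Qed.

Lemma triple_family_semisimple : semisimple R.
Proof.
pose f (t : unit + bool * bool * 'I_n) : R :=
  match t with inl _ => null_unit | inr u => block_unit u.1.1 u.1.2 u.2 u.2 end.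
have f_orth s t : f s * f t = f t *+ (s == t).
  case: s t => [[]|[[b r] i]] [[]|[[c s] j]] /=.
  - by rewrite null_unit_idem.
  - by rewrite null_mul_block_unit.
  - by rewrite block_unit_mul_null.
  rewrite block_unit_mul; case: andP => [[/eqP bc /andP[/eqP rs /eqP ij]]|neq].
    by rewrite bc rs ij eqxx.
  case: eqP => // -[bc rs ij]; by case: neq; rewrite bc rs ij !eqxx.
apply: (semisimple_of_idempotents f_orth) => [|[[]|[[b s] k]] /=].
- by rewrite big_sumType /= big_const card_unit /= addr0 null_unitE subrK.
- exact: (null_minimal e_gen mul_null_unit null_unit_idem).
pose v m := block_unit b s m k.
have v_eq : equivariant (twist_if b) ((-1) ^+ s) v.
  exact: matrix_unit_equivariant (twist_if_triple b).
apply: (equivariant_minimal (@twist_if_generating b) v_eq).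
  by rewrite signr_eq0.
by rewrite /v block_unit_mul !eqxx.
Qed.

End Decomposition.

End Twist.

End TripleFamilies.

(** * The envelope *)

Lemma monalgU_scale (F : fieldType) (K : monomType) (c : F) (m : K) :
  << c *g m >> = c *: << m >> :> {malg F[K]}.
Proof. by apply/malgP => k; rewrite mcoeffZ !mcoeffU mulrnAr mulr1. Qed.

Lemma envelope_generating (F : fieldType) (n : nat) :
  @generating F (envelope F n) n (fun i j => quot_map _ (e i j)).
Proof.
move=> V V0 VD VZ Ve x y Vy; have [{}x ->] := quot_map_surj x.
pose P z := V (quot_map (@relators F n) z * y).
have PD z t : P z -> P t -> P (z + t).
  by rewrite /P => Pz Pt; rewrite rmorphD mulrDl; apply: VD.
have PZ c z : P z -> P (c *: z).
  have PcE : quot_map (@relators F n) (c *: z) * y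
      = c *: (quot_map (@relators F n) z * y) :> envelope F n.
    by rewrite envelope_scalerAl; congr (_ * _); apply: quot_map_is_scalable.
  by rewrite /P PcE; apply: VZ.
rewrite -/(P x) [x]monalgE; elim/big_ind: _ => [|//|m _].
  by rewrite /P rmorph0 mul0r.
rewrite monalgU_scale; apply: PZ; case: m => m; rewrite /P.
elim: m => [|[i j] m IH].
  by rewrite -fmoneE rmorph1 mul1r.
have -> : << FMonom ((i, j) :: m) >>
    = e i j * << FMonom m >> :> free_algebra F n.
  rewrite /e malgM_def fgmulUU mulr1; congr << _ >>.
  by apply/val_inj; rewrite [RHS]fmM fmuE.
by rewrite rmorphM -mulrA; apply: Ve.
Qed.

(** The left side groups terms as [relator] does, the right side as
    [triple_family] does. *)
Lemma rmorph_bracket (A B : pzRingType) (q : {rmorphism A -> B})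
    a b c d d' (s s' : bool) :
  q (a * b * c - c * b * a - d *+ s + d' *+ s')
  = q a * q b * q c - q c * q b * q a - (q d *+ s - q d' *+ s').
Proof.
by rewrite rmorphD !rmorphB !rmorphMn !rmorphM /= opprB addrA [RHS]addrAC.
Qed.

Lemma envelope_triple (F : fieldType) (n : nat) :
  @triple_family F (envelope F n) n (fun i j => quot_map _ (e i j)).
Proof.
move=> i j k l m t; apply/eqP; rewrite -subr_eq0; apply/eqP.
have : quot_map _ (relator i j k l m t) = 0 :> envelope F n.
  by apply/quot_map_eq0 => I [_ sI]; apply: sI; exists i, j, k, l, m, t.
by rewrite /relator /bracket -!natrM !mulnb !scaler_nat rmorph_bracket.
Qed.

Theorem corollary6p3 (F : closedFieldType) (hF : [pchar F] =i pred0)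
    (n : nat) (hn : (2 <= n)%N) :
  semisimple (envelope F n).
Proof.
have two_neq0 : (2%:R : F) != 0 by rewrite ((pcharf0P F).1 hF).
have [iota iota2] : exists iota : F, iota * iota = -1.
  have [//|iota] := @solve_monicpoly F 2 (fun i => if i == 0%N then -1 else 0).
  by rewrite !big_ord_recl big_ord0 /= expr0 mulr1 mul0r !addr0; exists iota.
have [o oP] : exists o : 'I_n -> 'I_n, forall i, o i != i.
  case: n hn => [|[|n]] // _.
  exists (fun i => if i == ord0 then ord_max else ord0) => i.
  by case: (eqVneq i ord0) => [->|] //; rewrite eq_sym.
exact: (triple_family_semisimple oP two_neq0 iota2
  (@envelope_triple F n) (@envelope_generating F n)).
Qed.
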